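(* There is an absolute constant $C>0$ such that for all $u,b\in\mathbb{N}$ and every set $S\subseteq\mathbb{Z}_2^u$ with $2\le |S|\le 2^b$, \[ \mathbb{E}_{T\in_U \mathcal{L}(u,b)}\big[L(T,S)\big]\le C\log |S| . \] That is, $\mathbb{E}_{T\in_U \mathcal{L}(u,b)}[L(T,S)]=O(\log|S|)$.
   Context: $\mathbb{Z}_2^u$ denotes the $u$-dimensional vector space over the two-element field. $\mathcal{L}(u,b)$ denotes the set of all linear maps $\mathbb{Z}_2^u\to\mathbb{Z}_2^b$ (maps $\vec x\mapsto A\vec x$ with $A$ a binary $b\times u$ matrix). For $T\in\mathcal{L}(u,b)$ and $S\subseteq\mathbb{Z}_2^u$, $L(T,S)=\max_{\vec y\in\mathbb{Z}_2^b}|T^{-1}(\vec y)\cap S|$ is the size of a largest bin when the balls $S$ are placed into the bins $\mathbb{Z}_2^b$ by $T$. The notation $\mathbb{E}_{T\in_U H}$ and $\Pr_{T\in_U H}$ means the expectation/probability over a uniformly random choice of $T$ from the finite set $H$. All logarithms are to base 2. *)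

(* Defs.v *)
From mathcomp Require Import all_boot all_order all_algebra.
From Stdlib Require Import Reals.

Set Implicit Arguments.
Unset Strict Implicit.
Unset Printing Implicit Defensive.

(* Z_2^u is represented as column vectors 'cV['F_2]_u; a linear map
   Z_2^u -> Z_2^b is x |-> A *m x with A : 'M['F_2]_(b, u).  The map
   A |-> (x |-> A x) is a bijection onto L(u,b), so the uniform distribution
   on L(u,b) is the uniform distribution on matrices. *)

Definition maxload (u b : nat) (A : 'M['F_2]_(b, u)) (S : {set 'cV['F_2]_u}) : nat :=
  (\max_(y : 'cV['F_2]_b) #|[set x in S | mulmx A x == y]|)%N.

Definition expected_maxload (u b : nat) (S : {set 'cV['F_2]_u}) : R :=
  (INR (\sum_(A : 'M['F_2]_(b, u)) maxload A S)%N
   / INR #|{: 'M['F_2]_(b, u)}|)%R.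

Definition log2 (x : R) : R := (ln x / ln 2)%R.

(* Main.v *)
(**
  Write W = F_2^b, N = |W| and n = |S|, and place the balls S in W x F_2^u at the
  points (0, x).  Quotienting W x F_2^u by u successive random vectors, each
  killing one coordinate of F_2^u, ends with the bins W, the ball x falling in
  bin A x for a uniform matrix A.  For lambda = 1 + 1/r follow the potential
  Phi = sum over bins of (lambda^load - 1), which starts at p = n/r.  Merging two
  bins multiplies their lambda^load, so Phi never decreases, and when D bins
  remain after a step its expected increment in that step is at most Phi^2/(4D).
  As long as Phi <= p + n/2, the excess Psi = Phi - p therefore has expected
  increment at most (2 p^2 + n Psi)/(4D).  The D decrease geometrically down to
  N >= n, so the final excess, stopped at n/2, has expectation O(p^2/N), and
  Markov's inequality gives Pr[Phi >= p + n/2] <= 4/r^2.  Otherwise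
  lambda^L < 2n + 2 for the maximal load L, that is L < r l with
  l = log n + O(1).  The tail Pr[L >= r l] <= 4/r^2 is summable over r, whence
  E[L] <= 9 l.
*)

Require Import Defs.
From mathcomp Require Import all_boot all_order all_algebra.
From mathcomp Require Import ring lra.

Set Implicit Arguments.
Unset Strict Implicit.
Unset Printing Implicit Defensive.

Import Order.TTheory GRing.Theory Num.Theory.

Section LinearHashing.

Local Open Scope ring_scope.

(** * Counting and splitting off one coordinate over F_2 *)

Lemma card_F2 : #|{: 'F_2}| = 2%N.
Proof. by rewrite card_Fp. Qed.

Lemma card_cV_F2 n : #|{: 'cV['F_2]_n}| = (2 ^ n)%N.
Proof. by rewrite card_mx card_F2 muln1. Qed.

Lemma big_cV1_F2 (M : Type) (idx : M) (op : Monoid.com_law idx)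
    (G : 'cV['F_2]_1 -> M) :
  \big[op/idx]_x G x = op (G (const_mx 0)) (G (const_mx 1)).
Proof.
rewrite (reindex (fun a : 'F_2 => const_mx a)) /=; last first.
  exists (fun x : 'cV['F_2]_1 => x 0 0) => [a _|x _]; first by rewrite mxE.
  by apply/matrixP => i j; rewrite mxE !ord1.
rewrite big_ord_recl big_ord_recl big_ord0 Monoid.mulm1.
by congr (op (G (const_mx _)) (G (const_mx _))); apply/val_inj.
Qed.

Lemma big_cVS_F2 (M : Type) (idx : M) (op : Monoid.com_law idx) n
    (G : 'cV['F_2]_(1 + n) -> M) :
  \big[op/idx]_x G x =
  op (\big[op/idx]_x G (col_mx (const_mx 0) x))
     (\big[op/idx]_x G (col_mx (const_mx 1) x)).
Proof.
rewrite -(big_cV1_F2 op (fun a => \big[op/idx]_x G (col_mx a x))).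
rewrite pair_big /=; apply: reindex.
exists (fun x => (usubmx x, dsubmx x)) => [[a x] _|x _] /=.
  by rewrite col_mxKu col_mxKd.
by rewrite vsubmxK.
Qed.

Lemma sum_row_mx (F : nmodType) b n (G : 'M['F_2]_(b, 1 + n) -> F) :
  \sum_A G A = \sum_(w : 'cV['F_2]_b) \sum_A G (row_mx w A).
Proof.
rewrite pair_big /=; apply: reindex.
exists (fun A => (lsubmx A, rsubmx A)) => [[a x] _|x _] /=.
  by rewrite row_mxKl row_mxKr.
by rewrite hsubmxK.
Qed.

Lemma sum_const2 (F : pzSemiRingType) b n (x : F) :
  \sum_(w : 'cV['F_2]_b) \sum_(z : 'cV['F_2]_n) x = (2 ^ n)%:R * (2 ^ b)%:R * x.
Proof. by rewrite !sumr_const !card_cV_F2 -mulrnA -natrM mulr_natl. Qed.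

(** * The potential under random merging *)

Section Potential.

Variables (F : realFieldType) (b : nat).
Local Notation W := 'cV['F_2]_b.

(** [h] plays the role of lambda^load, so an empty bin has value 1 and contributes nothing. *)
Definition potential n (h : W -> 'cV['F_2]_n -> F) : F :=
  \sum_y \sum_x (h y x - 1).

(** The weights lambda^load after all quotients: the point (v, x) falls into bin v + A x. *)
Definition pushprod n (h : W -> 'cV['F_2]_n -> F) (A : 'M['F_2]_(b, n)) (y : W) : F :=
  \prod_x h (y - A *m x) x.

(* Identifies (y, 0, x) with (y - w, 1, x - z).  The component z has no effect on
   the law of the final bins (it only shifts the first column of the matrix, see
   [pushprod_merge]), but without it the merged pairs would not spread over all
   of W x F_2^n. *)
Definition merge n (w : W) (z : 'cV['F_2]_n) (h : W -> 'cV['F_2]_(1 + n) -> F) :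
    W -> 'cV['F_2]_n -> F :=
  fun y x => h y (col_mx (const_mx 0) x) * h (y - w) (col_mx (const_mx 1) (x - z)).

Lemma pushprod_merge n w (z : 'cV['F_2]_n) h A y :
  pushprod (merge w z h) A y = pushprod h (row_mx (w + A *m z) A) y.
Proof.
rewrite /pushprod big_cVS_F2 /merge big_split /=; congr (_ * _).
  apply: eq_bigr => x _; rewrite mul_row_col.
  by rewrite (_ : const_mx 0 = 0) ?mulmx0 ?add0r //; apply/matrixP => i j; rewrite !mxE.
rewrite [RHS](reindex_inj (addIr (- z))) /=; apply: eq_bigr => x _.
rewrite mul_row_col (_ : const_mx 1 = 1%:M); last first.
  by apply/matrixP => i j; rewrite !mxE !ord1.
by rewrite mulmx1 mulmxBr addrACA subrr addr0 opprD addrA addrAC.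
Qed.

(** For s, t >= 1, st - 1 exceeds (s - 1) + (t - 1) by (s - 1)(t - 1) >= 0. *)
Lemma potential_merge_ge n w (z : 'cV['F_2]_n) h :
  (forall y x, 1 <= h y x) -> potential h <= potential (merge w z h).
Proof.
move=> h1.
have -> : potential h =
    \sum_y \sum_x ((h y (col_mx (const_mx 0) x) - 1)
                   + (h (y - w) (col_mx (const_mx 1) (x - z)) - 1)).
  rewrite /potential; under [RHS]eq_bigr do rewrite big_split.
  under [LHS]eq_bigr do rewrite big_cVS_F2.
  rewrite !big_split /=; congr (_ + _).
  rewrite (reindex_inj (addIr (- w))) /=; apply: eq_bigr => y _.
  exact: (reindex_inj (addIr (- z))).
apply: ler_sum => y _; apply: ler_sum => x _; rewrite /merge.
have := h1 y (col_mx (const_mx 0) x).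
have := h1 (y - w) (col_mx (const_mx 1) (x - z)).
set s := h _ _; set t := h _ _; nra.
Qed.

(** The excess of each merged pair is a product (s - 1)(t - 1). As (w, z) varies, every point of one
    half meets every point of the other exactly once, so these products add up to [g 0 * g 1]. *)
Lemma sum_potential_merge n (h : W -> 'cV['F_2]_(1 + n) -> F) :
  let g a := \sum_y \sum_x (h y (col_mx (const_mx a) x) - 1) in
  \sum_w \sum_z potential (merge w z h) =
  (2 ^ n * 2 ^ b)%:R * potential h + g 0 * g 1.
Proof.
move=> g.
have gE a : g a = \sum_p (h p.1 (col_mx (const_mx a) p.2) - 1).
  by rewrite /g pair_big.
have hE : potential h = g 0 + g 1.
  rewrite /potential /g -big_split /=; apply: eq_bigr => y _.
  by rewrite big_cVS_F2.
rewrite pair_big /=.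
have mE (q : W * 'cV['F_2]_n) : potential (merge q.1 q.2 h) =
    g 0 + g 1 + \sum_p (h p.1 (col_mx (const_mx 0) p.2) - 1)
             * (h (p.1 - q.1) (col_mx (const_mx 1) (p.2 - q.2)) - 1).
  have -> : g 1 = \sum_p (h (p.1 - q.1) (col_mx (const_mx 1) (p.2 - q.2)) - 1).
    rewrite gE; apply: (reindex (fun p => (p.1 - q.1, p.2 - q.2))).
    exists (fun p => (p.1 + q.1, p.2 + q.2)) => [[p1 p2] _|[p1 p2] _] /=.
      by rewrite !subrK.
    by rewrite !addrK.
  rewrite gE -!big_split /= /potential pair_big /=; apply: eq_bigr => p _.
  by rewrite /merge; ring.
under eq_bigr do rewrite mE.
rewrite big_split /= sumr_const card_prod !card_cV_F2 -hE mulnC mulr_natl.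
congr (_ + _); rewrite exchange_big /= (gE 0) big_distrl /=.
apply: eq_bigr => p _; rewrite -big_distrr /=; congr (_ * _); rewrite gE.
rewrite [RHS](reindex (fun q => (p.1 - q.1, p.2 - q.2))) //=.
exists (fun q => (p.1 - q.1, p.2 - q.2)) => [[q1 q2] _|[q1 q2] _] /=;
  by rewrite !subKr.
Qed.

(** An unnormalised probability, taken in [F] to enter the estimates directly. *)
Definition badsum n (c : F) (h : W -> 'cV['F_2]_n -> F) : F :=
  \sum_A (c <= \sum_y (pushprod h A y - 1))%R%:R.

(** For fixed [z] and [A], the first column w + A z is uniform when w is, so each [z] yields every
    matrix once. *)
Lemma sum_badsum_merge n c (h : W -> 'cV['F_2]_(1 + n) -> F) :
  \sum_w \sum_z badsum c (merge w z h) = (2 ^ n)%:R * badsum c h.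
Proof.
rewrite exchange_big /= /badsum.
transitivity (\sum_(z : 'cV['F_2]_n)
  \sum_A (c <= \sum_y (pushprod h A y - 1))%R%:R : F).
  apply: eq_bigr => z _; rewrite [RHS]sum_row_mx [LHS]exchange_big [RHS]exchange_big /=.
  apply: eq_bigr => A _; rewrite [RHS](reindex_inj (addIr (A *m z))) /=.
  by apply: eq_bigr => w _; under eq_bigr do rewrite pushprod_merge.
by rewrite sumr_const card_cV_F2 mulr_natl.
Qed.

Lemma badsum_le_card n c (h : W -> 'cV['F_2]_n -> F) :
  badsum c h <= (2 ^ b)%:R ^+ n.
Proof.
rewrite -natrX -expnM -[X in (X ^ _)%N]card_F2 -(card_mx 'F_2 b n) -sum1_card natr_sum.
by apply: ler_sum => A _; rewrite lern1 leq_b1.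
Qed.

(* The induction on n is the stopped process: once the excess over p exceeds q the
   bound is trivial, and before that the quadratic increment is linear in it.
   The coefficient 2 - 2^-n bounds the product of the growth factors
   1 + 2^-(k+2) for k < n. *)
Lemma badsum_le n (p q : F) (h : W -> 'cV['F_2]_n -> F) :
  0 <= q -> 2 * q <= (2 ^ b)%:R ->
  (forall y x, 1 <= h y x) -> p <= potential h ->
  q * badsum (p + q) h <=
  (2 ^ b)%:R ^+ n * ((2 - 2 ^- n) * (potential h - p)
                     + 2 * (1 - 2 ^- n) * (p ^+ 2 / (2 ^ b)%:R)).
Proof.
move=> q0; set N := (2 ^ b)%:R => qN.
have N0 : 0 < N by rewrite ltr0n expn_gt0.
elim: n h => [|n IHn]; last rewrite -[n.+1]/(1 + n)%N; move=> h h1 ph.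
  (* Only the empty matrix is left: Markov's inequality reads q [p + q <= Phi] <= Phi - p. *)
  rewrite expr0 invr1 subrr mulr0 mul0r addr0 !mul1r.
  have -> : (2 - 1 : F) = 1 by ring.
  rewrite mul1r /badsum.
  have cV0E (x : 'cV['F_2]_0) : x = 0 by apply/matrixP => -[].
  have M0E (A : 'M['F_2]_(b, 0)) : A = 0 by apply/matrixP => ? -[].
  have unE (M : Type) (idx : M) (op : Monoid.com_law idx) (G : 'cV['F_2]_0 -> M) :
      \big[op/idx]_x G x = G 0.
    by rewrite (big_pred1 0) => [|x] /=; rewrite ?(cV0E x) ?eqxx.
  rewrite (big_pred1 (0 : 'M_(b, 0))); last by move=> A; rewrite (M0E A) /= eqxx.
  have -> : \sum_y (pushprod h 0 y - 1) = potential h.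
    by apply: eq_bigr => y _; rewrite /pushprod !unE mulmx0 subr0.
  by case: (lerP (p + q)) => ?; rewrite ?mulr1n ?mulr0n; lra.
have t0 : 0 < 2 ^- n :> F by rewrite invr_gt0 exprn_gt0.
have t1 : 2 ^- n <= 1 :> F by rewrite invf_le1 ?exprn_gt0 // exprn_ege1 // ler1n.
have tS : 2 ^- (1 + n) = 2 ^- n / 2 :> F by rewrite add1n exprSr invfM.
set T : F := (2 ^ n)%:R.
have TE : T * 2 ^- n = 1 by rewrite /T natrX mulfV // expf_neq0 // pnatr_eq0.
have T0 : 0 < T by rewrite ltr0n expn_gt0.
rewrite tS; move: t0 t1 TE; set t := 2 ^- n => t0 t1 TE.
set Psi := potential h - p; have Psi0 : 0 <= Psi by rewrite subr_ge0.
have p2N : 0 <= p ^+ 2 / N by rewrite divr_ge0 ?sqr_ge0 // ltW.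
have NX k : 0 < N ^+ k by rewrite exprn_gt0.
have [qPsi|Psiq] := lerP q Psi.
  have := badsum_le_card (p + q) h; rewrite -/N => /(ler_wpM2l q0) /le_trans; apply.
  rewrite mulrC; apply: ler_wpM2l; first exact: ltW (NX _).
  have : 0 <= (1 - t / 2) * Psi by apply: mulr_ge0 => //; lra.
  have : 0 <= (1 - t / 2) * (p ^+ 2 / N) by apply: mulr_ge0 => //; lra.
  lra.
pose g a := \sum_y \sum_x (h y (col_mx (const_mx a) x) - 1).
have hE : potential h = g 0 + g 1.
  rewrite /potential /g -big_split /=; apply: eq_bigr => y _.
  by rewrite big_cVS_F2.
(* Sum the induction hypothesis over all merges (w, z). *)
have key : T * (q * badsum (p + q) h) <=
    N ^+ n * ((2 - t) * (T * N * Psi + g 0 * g 1)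
              + T * N * (2 * (1 - t) * (p ^+ 2 / N))).
  rewrite mulrCA -sum_badsum_merge mulr_sumr.
  have -> : T * N * Psi + g 0 * g 1 =
      \sum_w \sum_z (potential (@merge n w z h) - p).
    under eq_bigr do rewrite sumrB.
    rewrite sumrB sum_potential_merge -/(g 0) -/(g 1) /Psi.
    by rewrite sum_const2 natrM -/N -/T; ring.
  have -> : T * N * (2 * (1 - t) * (p ^+ 2 / N)) =
      \sum_(w : W) \sum_(z : 'cV['F_2]_n) (2 * (1 - t) * (p ^+ 2 / N)).
    by rewrite sum_const2.
  rewrite !mulr_sumr -big_split mulr_sumr; apply: ler_sum => w _.
  rewrite !mulr_sumr -big_split mulr_sumr; apply: ler_sum => z _.
  apply: IHn => [y x|]; last exact: le_trans ph (potential_merge_ge _ _ h1).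
  by rewrite /merge mulr_ege1.
rewrite -(ler_pM2l T0); apply: (le_trans key).
rewrite add1n (exprSr N n) -subr_ge0.
set c := p ^+ 2 / N; have cN : c * N = p ^+ 2 by rewrite divfK // gt_eqF.
(* The two coefficients grow by t/2 and t in this step; that growth has to absorb the cross term. *)
rewrite [X in 0 <= X](_ : _ = N ^+ n * ((T * t) * (N * Psi / 2 + c * N)
                                        - (2 - t) * (g 0 * g 1))); last by field.
rewrite TE mul1r cN; apply: mulr_ge0; first exact: ltW (NX _).
(* 2 g0 g1 <= (p + Psi)^2 / 2 <= p^2 + Psi^2, and Psi < q <= N/2 makes the last square at most N Psi
   / 2. *)
have g4 : 4 * (g 0 * g 1) <= (p + Psi) ^+ 2.
  rewrite (_ : p + Psi = g 0 + g 1) /Psi; last by rewrite hE; ring.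
  by have := sqr_ge0 (g 0 - g 1); nra.
have gp a : 0 <= g a.
  by apply: sumr_ge0 => y _; apply: sumr_ge0 => x _; rewrite subr_ge0.
have gg : 0 <= t * (g 0 * g 1) by rewrite !mulr_ge0 ?gp // (ltW t0).
have PP : Psi ^+ 2 <= q * Psi by rewrite expr2 ler_wpM2r // ltW.
have qP : 2 * q * Psi <= N * Psi by rewrite ler_wpM2r.
have := sqr_ge0 (p - Psi); nra.
Qed.

End Potential.

(** * The tail of the maximal load *)

Lemma card_maxload_ge b u (S : {set 'cV['F_2]_u}) (r l : nat) :
  (0 < r)%N -> (0 < #|S| <= 2 ^ b)%N -> (2 * #|S|.+1 <= 2 ^ l)%N ->
  (#|[set A : 'M['F_2]_(b, u) | r * l <= maxload A S]| * r ^ 2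
     <= 4 * #|{: 'M['F_2]_(b, u)}|)%N.
Proof.
have aux (a x y z : rat) :
    0 < a -> 2 * (a + 1) <= x -> y <= a -> 0 <= z -> y + a / 2 <= x - 1 + z by lra.
move=> r0 /andP[S0 Sb] Sl.
set cnt := #|[set A : 'M_(b, u) | _]|; set M := #|{: 'M['F_2]_(b, u)}|.
set n : rat := #|S|%:R; set N : rat := (2 ^ b)%:R; set e : rat := r%:R^-1.
have r0' : 0 < r%:R :> rat by rewrite ltr0n.
have e0 : 0 < e by rewrite invr_gt0.
have n0 : 0 < n by rewrite ltr0n.
have nN : n <= N by rewrite ler_nat.
have N0 : 0 < N by rewrite ltr0n expn_gt0.
have e1 : e <= 1 by rewrite invf_le1 // ler1n.
pose h (y : 'cV['F_2]_b) (x : 'cV['F_2]_u) : rat :=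
  if (y == 0) && (x \in S) then 1 + e else 1.
have h1 y x : 1 <= h y x by rewrite /h; case: ifP => _ //; rewrite lerDl ltW.
have potE : potential h = n * e.
  rewrite /potential (bigD1 0) //= [X in _ + X]big1 ?addr0; last first.
    by move=> y /negPf y0; rewrite big1 // => x _; rewrite /h y0 subrr.
  rewrite /h eqxx /= (bigID (mem S)) /= [X in _ + X]big1 ?addr0; last first.
    by move=> x /negPf ->; rewrite subrr.
  under eq_bigr => x xS do rewrite xS addrC addKr.
  by rewrite sumr_const mulr_natl.
have prodE (A : 'M_(b, u)) y :
    pushprod h A y = (1 + e) ^+ #|[set x in S | A *m x == y]|.
  rewrite /pushprod -prodr_const [RHS]big_mkcond /=; apply: eq_bigr => x _.
  by rewrite inE /h subr_eq0 eq_sym andbC.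
have e1n k : 1 <= (1 + e) ^+ k by rewrite exprn_ege1 // lerDl ltW.
(* One heavy bin suffices: lambda^r >= 2 gives lambda^(r l) >= 2^l >= 2n + 2, while n e + n/2 <=
   3n/2. *)
have bad (A : 'M_(b, u)) : (r * l <= maxload A S)%N ->
    n * e + n / 2 <= \sum_y (pushprod h A y - 1).
  have W0 : (0 < #|{: 'cV['F_2]_b}|)%N by rewrite card_cV_F2 expn_gt0.
  have [y yE] := bigop.eq_bigmax (fun y => #|[set x in S | A *m x == y]|) W0.
  rewrite /maxload yE => Ly.
  rewrite (bigD1 y) //= prodE.
  have sum0 : 0 <= \sum_(z | z != y) (pushprod h A z - 1).
    by apply: sumr_ge0 => z _; rewrite prodE subr_ge0.
  have : (1 + e) ^+ (r * l) <= (1 + e) ^+ #|[set x in S | A *m x == y]|.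
    by rewrite ler_weXn2l // lerDl ltW.
  have : 2 <= (1 + e) ^+ r.
    (* Bernoulli *)
    have : 1 + r%:R * e <= (1 + e) ^+ r.
      elim: (r) => [|k IHk]; first by rewrite mul0r addr0 expr0.
      rewrite exprSr -[k.+1]addn1 natrD.
      have : 0 <= k%:R * e * e by rewrite !mulr_ge0 // ltW.
      have : (1 + k%:R * e) * (1 + e) <= (1 + e) ^+ k * (1 + e).
        by rewrite ler_wpM2r // addr_ge0 // ltW.
      lra.
    by rewrite mulfV ?gt_eqF.
  move=> /(lerXn2r l) -/(_ _ _); rewrite !nnegrE => /(_ isT).
  move=> /(_ (le_trans ler01 (e1n r))); rewrite -exprM => H1 H2.
  have H3 : 2 * (n + 1) <= 2 ^+ l by rewrite /n natr1 -natrX -natrM ler_nat.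
  apply: aux => //; first exact: le_trans H3 (le_trans H1 H2).
  by rewrite -[leRHS]mulr1 ler_wpM2l // ltW.
have cntE : cnt%:R <= badsum (n * e + n / 2) h.
  rewrite /cnt -sum1_card big_mkcond natr_sum; apply: ler_sum => A _ /=.
  by rewrite inE; case: ifP => // /bad ->.
have q0 : 0 < n / 2 by rewrite divr_gt0.
have q2 : 2 * (n / 2) <= N by rewrite mulrC divfK.
(* With [p] the initial potential the starting excess is 0, and only the p^2/N term survives. *)
have := badsum_le (ltW q0) q2 h1 (lexx _); rewrite potE subrr mulr0 add0r.
have -> : (2 ^ b)%:R ^+ u = M%:R :> rat.
  by rewrite -natrX -expnM /M card_mx card_F2.
rewrite -/N => /(le_trans (ler_wpM2l (ltW q0) cntE)) H.
have {}H : n / 2 * cnt%:R <= M%:R * (2 * ((n * e) ^+ 2 / N)).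
  apply: (le_trans H); rewrite ler_wpM2l // -mulrA ler_pM2l // ler_piMl //.
    by rewrite divr_ge0 ?sqr_ge0 // ltW.
  by rewrite gerBl invr_ge0 exprn_ge0.
rewrite -(ler_nat rat) natrM natrX natrM.
suff : (n * N / 2) * (cnt%:R * r%:R ^+ 2) <= (n * N / 2) * (4 * M%:R).
  by rewrite ler_pM2l // divr_gt0 // mulr_gt0.
have -> : n * N / 2 * (cnt%:R * r%:R ^+ 2) = n / 2 * cnt%:R * (N * r%:R ^+ 2) by ring.
apply: (@le_trans _ _ (M%:R * (2 * ((n * e) ^+ 2 / N)) * (N * r%:R ^+ 2))).
  by rewrite ler_wpM2r // mulr_ge0 ?sqr_ge0 // ltW.
have -> : M%:R * (2 * ((n * e) ^+ 2 / N)) * (N * r%:R ^+ 2) = 2 * M%:R * n * n.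
  by rewrite /e; field; rewrite !gt_eqF.
have -> : n * N / 2 * (4 * M%:R) = 2 * M%:R * n * N by field.
by rewrite ler_wpM2l // !mulr_ge0 // ltW.
Qed.

(** * From the tail to the expectation *)

Lemma sum_inv_square_le (c : nat -> nat) (M k : nat) :
  (forall r, c r <= M)%N -> (forall r, 0 < r -> c r * r ^ 2 <= 4 * M)%N ->
  (\sum_(r < k) c r <= 9 * M)%N.
Proof.
move=> cM cr.
(* The terms r = 0 and r = 1 cost M and 4M; the others telescope by 1/r^2 <= 1/(r - 1) - 1/r. *)
suff H : (\sum_(r < k.+2) c r)%:R <= M%:R * (9 - 4 / k.+1%:R) :> rat.
  rewrite -(ler_nat rat) natrM; apply: le_trans (le_trans H _).
    by rewrite ler_nat !big_ord_recr /= -addnA leq_addr.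
  by rewrite mulrC ler_wpM2r // gerBl divr_ge0.
elim: k => [|k IHk].
  rewrite !big_ord_recr big_ord0 /= add0n invr1 mulr1.
  rewrite (_ : _ - _ = 5%:R); last by lra.
  by rewrite -natrM ler_nat -[5%N]/(1 + 4)%N mulnDr muln1 leq_add // mulnC -[c 1%N]muln1 cr.
rewrite big_ord_recr natrD /=.
apply: le_trans (lerD IHk (_ : _ <= M%:R * (4 / k.+2%:R ^+ 2))) _.
  rewrite mulrA ler_pdivlMr ?exprn_gt0 // -natrX -!natrM ler_nat [leqRHS]mulnC.
  exact: cr.
rewrite -mulrDr ler_wpM2l //.
have -> : k.+2%:R = k.+1%:R + 1 :> rat by rewrite natr1.
have : 0 < k.+1%:R :> rat by rewrite ltr0n.
move: (k.+1%:R : rat) => x x0; have x1 : 0 < x + 1 by rewrite addr_gt0.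
rewrite -subr_ge0.
have -> : 9 - 4 / (x + 1) - (9 - 4 / x + 4 / (x + 1) ^+ 2) = 4 / (x * (x + 1) ^+ 2).
  by field; rewrite (gt_eqF x0) (gt_eqF x1).
by rewrite divr_ge0 // mulr_ge0 ?sqr_ge0 // ltW.
Qed.

(** Layer-cake formula in blocks of length [l]: each r with r l <= L pays for the block from r l to
    (r + 1) l. The cap k l keeps the sum finite. *)
Lemma leq_sum_multiples (L l k : nat) :
  (minn L (k * l) <= l * \sum_(r < k) (r * l <= L))%N.
Proof.
elim: k => [|k IHk]; first by rewrite mul0n minn0.
rewrite big_ord_recr mulnDr /=; have [kL|Lk] := leqP (k * l) L.
  move: IHk; rewrite (minn_idPr kL) muln1 => IHk.
  by apply: leq_trans (geq_minr _ _) _; rewrite mulSn addnC leq_add2r.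
move: IHk; rewrite (minn_idPl (ltnW Lk)) muln0 addn0.
exact: leq_trans (geq_minl _ _).
Qed.

Lemma maxload_le_card b u (A : 'M['F_2]_(b, u)) S : (maxload A S <= #|S|)%N.
Proof. by apply/bigmax_leqP => y _; apply/subset_leq_card/subsetP => x /[!inE] /andP[]. Qed.

Lemma sum_maxload_le b u (S : {set 'cV['F_2]_u}) (l : nat) :
  (0 < #|S| <= 2 ^ b)%N -> (2 * #|S|.+1 <= 2 ^ l)%N ->
  (\sum_(A : 'M['F_2]_(b, u)) maxload A S <= 9 * l * #|{: 'M['F_2]_(b, u)}|)%N.
Proof.
move=> Sb Sl.
have l0 : (0 < l)%N by case: l Sl => //; rewrite mulnS.
have LA (A : 'M_(b, u)) :
    (maxload A S <= l * \sum_(r < #|S|) (r * l <= maxload A S))%N.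
  have LS := leq_trans (maxload_le_card A S) (leq_pmulr #|S| l0).
  by have := leq_sum_multiples (maxload A S) l #|S|; rewrite (minn_idPl LS).
apply: (@leq_trans (\sum_(A : 'M['F_2]_(b, u)) l * \sum_(r < #|S|) (r * l <= maxload A S))%N).
  by apply: leq_sum => A _; exact: LA.
rewrite -big_distrr /= exchange_big /= [leqRHS]mulnAC mulnC leq_mul2r.
apply/orP; right.
pose c r := #|[set A : 'M['F_2]_(b, u) | r * l <= maxload A S]%N|.
rewrite (eq_bigr (fun r : 'I__ => c r)); last first.
  by move=> r _; rewrite /c -sum1dep_card [RHS]big_mkcond /=; apply: eq_bigr => A _; case: (_ <= _)%N.
apply: (sum_inv_square_le (c := c)) => [r|r r0]; first exact: max_card.
exact: card_maxload_ge.
Qed.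

End LinearHashing.

(* Passage to real numbers and base-2 logarithms *)
From Stdlib Require Import Reals Lra.

Lemma pow2E k : Nat.pow 2 k = expn 2 k.
Proof. by elim: k => // k IHk; rewrite expnS -IHk. Qed.

Lemma INR_expn2 k : INR (expn 2 k) = (2 ^ k)%R.
Proof. by elim: k => [|k IHk]; rewrite ?expn0 // expnS -multE mult_INR IHk. Qed.

Lemma trunc_log_le_log2 n : (0 < n)%N -> (INR (trunc_log 2 n) <= log2 (INR n))%R.
Proof.
move=> n0; have ln2 : (0 < ln 2)%R by rewrite -ln_1; apply: ln_increasing; Lra.lra.
apply: (Rmult_le_reg_r (ln 2)) => //.
rewrite /log2 /Rdiv Rmult_assoc Rinv_l ?Rmult_1_r; last by apply: Rgt_not_eq.
rewrite -ln_pow; last by Lra.lra.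
rewrite -INR_expn2; have /ssrnat.leP/le_INR : (expn 2 (trunc_log 2 n) <= n)%N by apply: trunc_logP.
case=> [lt|->]; last exact: Rle_refl.
by apply/Rlt_le/ln_increasing => //; apply/lt_0_INR/ssrnat.ltP; rewrite expn_gt0.
Qed.

Theorem theorem1 :
  exists C : R, (0 < C)%R /\
    forall (u b : nat) (S : {set 'cV['F_2]_u}),
      (2 <= #|S| <= 2 ^ b)%N ->
      (expected_maxload b S <= C * log2 (INR #|S|))%R.
Proof.
(* 27 = 9 * 3: with t = [trunc_log 2 #|S|], the bound 9 (t + 2) is at most 27 t because |S| >= 2
   gives t >= 1. *)
exists 27%R; split; first by Lra.lra.
move=> u b S /andP[S2 Sb]; rewrite ?pow2E in Sb.
have S0 : (0 < #|S|)%N by exact: leq_trans S2.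
(* One unit above t gives |S| + 1 <= 2^(t + 1); the second supplies the factor 2. *)
pose l := (trunc_log 2 #|S|).+2.
have Sl : (2 * #|S|.+1 <= expn 2 l)%N.
  by rewrite [expn 2 l]expnS leq_mul2l /= trunc_log_ltn.
have /sum_maxload_le/(_ Sl)/ssrnat.leP/le_INR : (0 < #|S| <= expn 2 b)%N by rewrite S0.
rewrite -!multE !mult_INR => H.
have M0 : (0 < INR #|{: 'M['F_2]_(b, u)}|)%R.
  by apply/lt_0_INR/ssrnat.ltP; rewrite card_mx expn_gt0 card_F2.
have lE : (INR l = INR (trunc_log 2 #|S|) + 2)%R by rewrite !S_INR; Lra.lra.
have tl := trunc_log_le_log2 S0.
have tl1 : (1 <= INR (trunc_log 2 #|S|))%R.
  by rewrite -[1%R]/(INR 1); apply/le_INR/ssrnat.leP/trunc_log_max.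
rewrite /expected_maxload; apply: (Rmult_le_reg_r _ _ _ M0).
rewrite /Rdiv Rmult_assoc Rinv_l ?Rmult_1_r; last exact: Rgt_not_eq.
apply: (Rle_trans _ _ _ H); apply: Rmult_le_compat_r; first exact: Rlt_le.
rewrite lE (_ : INR 9 = 9%R); last by rewrite /=; Lra.lra.
Lra.lra.
Qed.
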